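(* Let $p$ be the mesh pattern $(12,R)$ with $R=\{(0,0),(0,1),(1,1),(1,2),(2,0),(2,2)\}$, let $E(t,u)=\sum_{n\ge0}t^n\sum_{\sigma\in K_n}u^{p(\sigma)}$, and let $P(t)=\sum_{n\ge0}|K_n(p)|t^n$. Then $$P(t)=\left(1+t^2-\frac{t^2A(t)^2}{(1+t)^2}\right)A(t),\qquad E(t,u)=\left(1+t^2(1-u)\Big(1-\frac{A(t)^2}{(1+t)^2}\Big)\right)A(t).$$ The initial terms of $E(t,u)$ are $1+t+2t^4+14t^5+(86+4u)t^6+(618+28u)t^7+(5062+180u)t^8+\cdots$.
   Context: A permutation $\sigma=\sigma_1\cdots\sigma_n$ of $\{1,\dots,n\}$ is a king permutation if $|\sigma_{i+1}-\sigma_i|>1$ for all $1\le i\le n-1$. $K_n$ is the set of king permutations of length $n$ ($K_0$ = the empty permutation, $K_1=\{1\}$) and $A(t)=\sum_{n\ge0}|K_n|t^n$ (known to equal $\sum_{n\ge0}n!\,t^n(1-t)^n/(1+t)^n$). For a mesh pattern $p=(12,R)$ with $R\subseteq\{0,1,2\}^2$, an occurrence of $p$ in $\sigma\in S_n$ is a pair of positions $i_1<i_2$ with $\sigma_{i_1}<\sigma_{i_2}$ such that for every $(x,y)\in R$ there is no position $m$ with $i_x<m<i_{x+1}$ and $v_y<\sigma_m<v_{y+1}$, where $i_0=0$, $i_3=n+1$, $v_0=0$, $v_1=\sigma_{i_1}$, $v_2=\sigma_{i_2}$, $v_3=n+1$ (first coordinate of a box indexes positions, second values). $p(\sigma)$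 is the number of occurrences of $p$ in $\sigma$; $K_n(p)$ is the set of king $n$-permutations with $p(\sigma)=0$. *)

(* Defs.v *)
From HB Require Import structures.
From mathcomp Require Import all_boot all_order all_fingroup all_algebra.
From mathcomp Require Import boolp.

Set Implicit Arguments.
Unset Strict Implicit.
Unset Printing Implicit Defensive.

Import GRing.Theory.
Local Open Scope ring_scope.

(* A record rather than nat -> R, so that the Cauchy product does not compete
   with the pointwise structures on functions. *)
Record fps (R : Type) : Type := Fps { fps_coef : nat -> R }.

Notation "f .[# n ]" := (fps_coef f n)
  (at level 1, left associativity, format "f .[# n ]") : ring_scope.

HB.instance Definition _ (R : Type) := gen_eqMixin (fps R).
HB.instance Definition _ (R : Type) := gen_choiceMixin (fps R).

Lemma fps_ext (R : Type) (f g : fps R) : (forall n, f.[# n] = g.[# n]) -> f = g.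
Proof. by case: f g => [f] [g] /= /funext ->. Qed.

Definition fps_zero (R : zmodType) : fps R := Fps (fun=> 0).
Definition fps_opp (R : zmodType) (f : fps R) : fps R :=
  Fps (fun n => - f.[# n]).
Definition fps_add (R : zmodType) (f g : fps R) : fps R :=
  Fps (fun n => f.[# n] + g.[# n]).

Fact fps_addA (R : zmodType) : associative (@fps_add R).
Proof. by move=> f g h; apply: fps_ext => n /=; rewrite addrA. Qed.
Fact fps_addC (R : zmodType) : commutative (@fps_add R).
Proof. by move=> f g; apply: fps_ext => n /=; rewrite addrC. Qed.
Fact fps_add0 (R : zmodType) : left_id (fps_zero R) (@fps_add R).
Proof. by move=> f; apply: fps_ext => n /=; rewrite add0r. Qed.
Fact fps_addN (R : zmodType) :
  left_inverse (fps_zero R) (@fps_opp R) (@fps_add R).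
Proof. by move=> f; apply: fps_ext => n /=; rewrite addNr. Qed.

HB.instance Definition _ (R : zmodType) := GRing.isZmodule.Build (fps R)
  (@fps_addA R) (@fps_addC R) (@fps_add0 R) (@fps_addN R).

Definition fps_const (R : nzRingType) (c : R) : fps R :=
  Fps (fun n => if n == 0%N then c else 0).
Definition fps_mul (R : nzRingType) (f g : fps R) : fps R :=
  Fps (fun n => \sum_(i < n.+1) f.[# i] * g.[# n - i]).

Definition fps_trunc (R : nzRingType) (m : nat) (f : fps R) : {poly R} :=
  \poly_(i < m) f.[# i].

Lemma coef_fps_trunc (R : nzRingType) m (f : fps R) n : (n < m)%N ->
  (fps_trunc m f)`_n = f.[# n].
Proof. by rewrite coef_poly => ->. Qed.

Lemma fps_mul_trunc (R : nzRingType) m (f g : fps R) n : (n < m)%N ->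
  (fps_mul f g).[# n] = (fps_trunc m f * fps_trunc m g)`_n.
Proof.
move=> lt_nm; rewrite coefM /=; apply: eq_bigr => i _.
by rewrite !coef_fps_trunc // (leq_ltn_trans _ lt_nm) ?leq_subr // -ltnS.
Qed.

Fact fps_mulA (R : comNzRingType) : associative (@fps_mul R).
Proof.
move=> f g h; apply: fps_ext => n.
transitivity ((fps_trunc n.+1 f * fps_trunc n.+1 g * fps_trunc n.+1 h)`_n).
  rewrite -mulrA coefM [LHS]/=; apply: eq_bigr => i _.
  by rewrite -(fps_mul_trunc (m := n.+1)) ?coef_fps_trunc // ltnS leq_subr.
rewrite coefM [RHS]/=; apply: eq_bigr => i _.
rewrite -(fps_mul_trunc (m := n.+1)) // coef_fps_trunc //.
by rewrite ltnS leq_subr.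
Qed.

Fact fps_mulC (R : comNzRingType) : commutative (@fps_mul R).
Proof.
by move=> f g; apply: fps_ext => n; rewrite !(fps_mul_trunc (m := n.+1)) // mulrC.
Qed.

Fact fps_mul1 (R : comNzRingType) : left_id (fps_const 1) (@fps_mul R).
Proof.
move=> f; apply: fps_ext => n /=.
by rewrite big_ord_recl /= mul1r subn0 big1 ?addr0 // => i _; rewrite mul0r.
Qed.

Fact fps_mulDl (R : comNzRingType) :
  left_distributive (@fps_mul R) (@fps_add R).
Proof.
move=> f g h; apply: fps_ext => n /=.
by rewrite -big_split; apply: eq_bigr => i _; rewrite mulrDl.
Qed.

Fact fps_one_neq0 (R : comNzRingType) : fps_const 1 != 0 :> fps R.
Proof.
by apply/eqP => /(congr1 (fun f => f.[# 0])) /= /eqP; rewrite oner_eq0.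
Qed.

HB.instance Definition _ (R : comNzRingType) :=
  GRing.Zmodule_isComNzRing.Build (fps R)
    (@fps_mulA R) (@fps_mulC R) (@fps_mul1 R) (@fps_mulDl R) (@fps_one_neq0 R).

(* For g = 1 / f: the list g_n, ..., g_0, by the recurrence
   g_(n+1) = - f_0^-1 * (f_1 g_n + ... + f_(n+1) g_0). *)
Fixpoint fps_inv_seq (R : comUnitRingType) (f : fps R) (n : nat) : seq R :=
  if n isn't k.+1 then [:: f.[# 0]^-1] else
  let s := fps_inv_seq f k in
  (- f.[# 0]^-1 * \sum_(i < k.+1) f.[# i.+1] * s`_i) :: s.

Definition fps_unit (R : comUnitRingType) : {pred fps R} :=
  fun f => f.[# 0] \is a GRing.unit.

Definition fps_inv (R : comUnitRingType) (f : fps R) : fps R :=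
  if fps_unit f then Fps (fun n => (fps_inv_seq f n)`_0) else f.

Lemma fps_inv_seqE (R : comUnitRingType) (f : fps R) n i : (i <= n)%N ->
  (fps_inv_seq f n)`_i = (fps_inv_seq f (n - i))`_0.
Proof.
elim: n i => [|n IHn] [|i] //= le_in.
by rewrite subSS IHn.
Qed.

Fact fps_mulV (R : comUnitRingType) :
  {in @fps_unit R, left_inverse 1 (@fps_inv R) *%R}.
Proof.
move=> f; rewrite unfold_in => Uf; rewrite /fps_inv /fps_unit Uf mulrC.
apply: fps_ext => -[|n].
  by rewrite [LHS]/= big_ord1 /= mulrV.
rewrite [LHS]/= big_ord_recl [X in X + _]/= mulrA mulrN mulrV // mulN1r.
rewrite [RHS]/=; apply/eqP; rewrite addrC subr_eq0; apply/eqP.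
by apply: eq_bigr => i _; rewrite /= -fps_inv_seqE // -ltnS.
Qed.

Fact fps_unitPl (R : comUnitRingType) (f g : fps R) : g * f = 1 -> fps_unit f.
Proof.
move=> /(congr1 (fun h => h.[# 0])); rewrite [LHS]/= big_ord1 /= => gf1.
by apply/unitrPr; exists g.[# 0]; rewrite mulrC.
Qed.

Fact fps_inv_out (R : comUnitRingType) :
  {in [predC @fps_unit R], @fps_inv R =1 id}.
Proof. by move=> f; rewrite inE /fps_inv /fps_unit unfold_in => /negbTE ->. Qed.

HB.instance Definition _ (R : comUnitRingType) :=
  GRing.ComNzRing_hasMulInverse.Build (fps R)
    (@fps_mulV R) (@fps_unitPl R) (@fps_inv_out R).

Definition fpsX (R : nzRingType) : fps R :=
  Fps (fun n => if n == 1%N then 1 else 0).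

Lemma fps_unit_1X (R : comUnitRingType) :
  (1 + fpsX R \is a GRing.unit) && ((1 + fpsX R) ^+ 2 \is a GRing.unit).
Proof.
suff U : 1 + fpsX R \is a GRing.unit by rewrite unitrX U.
by rewrite /= unfold_in /= /fps_unit /= addr0 unitr1.
Qed.

(* A permutation of {1, ..., n} is s : 'S_n; the 1-based position i and
   value sigma_i correspond to i.-1 : 'I_n and (s i.-1).+1. *)

Definition king (n : nat) : {set 'S_n} :=
  [set s : 'S_n | [forall i : 'I_n, forall j : 'I_n,
     (j == i.+1 :> nat) ==> (1 < `|(s j)%:Z - (s i)%:Z|)]].

(* A box (x, y) has x indexing positions and y indexing values. *)
Definition boxes := {set 'I_3 * 'I_3}.

Definition pos_line (n : nat) (i1 i2 : 'I_n) (x : nat) : nat :=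
  nth 0%N [:: 0; i1.+1; i2.+1; n.+1]%N x.

Definition val_line (n : nat) (s : 'S_n) (i1 i2 : 'I_n) (y : nat) : nat :=
  nth 0%N [:: 0; (s i1).+1; (s i2).+1; n.+1]%N y.

Definition occurrences12 (B : boxes) (n : nat) (s : 'S_n) : {set 'I_n * 'I_n} :=
  [set o : 'I_n * 'I_n | [&& (o.1 < o.2)%N, (s o.1 < s o.2)%N &
     [forall b in B, ~~ [exists m : 'I_n,
        (pos_line o.1 o.2 b.1 < m.+1 < pos_line o.1 o.2 b.1.+1)%N &&
        (val_line s o.1 o.2 b.2 < (s m).+1 < val_line s o.1 o.2 b.2.+1)%N]]]].

Definition nocc12 (B : boxes) (n : nat) (s : 'S_n) : nat :=
  #|occurrences12 B s|.

Definition king_avoid12 (B : boxes) (n : nat) : {set 'S_n} :=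
  [set s in king n | nocc12 B s == 0%N].

Definition king_gf (R : nzRingType) : fps R := Fps (fun n => #|king n|%:R).

Definition king_avoid12_gf (B : boxes) : fps int :=
  Fps (fun n => #|king_avoid12 B n|%:R).

(* An element of Z[u][[t]]; u is the polynomial variable 'X. *)
Definition king_dist12_gf (B : boxes) : fps {poly int} :=
  Fps (fun n => \sum_(s in king n) 'X^(nocc12 B s)).

Definition R_boxes : boxes :=
  [set b : 'I_3 * 'I_3 | (nat_of_ord b.1, nat_of_ord b.2) \in
     [:: (0, 0); (0, 1); (1, 1); (1, 2); (2, 0); (2, 2)]%N].

(* Main.v *)
(** An occurrence of the pattern at letters x < y cuts the word of the
    permutation as H x L y M with L < x < M < y < H, and two such cuts cannot
    coexist.  The king condition on H x L y M says that H, L and M standardise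
    to king permutations, that neither L nor M starts with its maximum, and
    that L and M are not both empty.  Let B(t) count the king permutations not
    starting with their maximum; prepending a new maximum to such a permutation
    gives exactly the others, so A = (1 + t) B.  Hence t^2 A (B^2 - 1) counts
    the king permutations with an occurrence, and each has exactly one. *)

Require Import Defs.
From mathcomp Require Import all_boot all_order all_fingroup all_algebra.
From mathcomp Require Import zify ring.

Set Implicit Arguments.
Unset Strict Implicit.
Unset Printing Implicit Defensive.

Import GRing.Theory.
Local Open Scope ring_scope.

(** * Combinatorial classes listed by size, and their products *)

Definition class_mul (T U : eqType) (X : nat -> seq T) (Y : nat -> seq U) n :=
  [seq p | k <- iota 0 n.+1, p <- [seq (x, y) | x <- X k, y <- Y (n - k)%N]].

Definition class_gf (R : nzRingType) (T : eqType) (X : nat -> seq T) : fps R :=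
  Fps (fun n => (size (X n))%:R).

(** A class is presented by duplicate-free lists, one for each size, so that list lengths are
    cardinalities and small cases can be computed. *)
Definition enumerates (T : eqType) (sz : T -> nat) (P : pred T)
    (X : nat -> seq T) :=
  forall n, uniq (X n) /\ (forall x, (x \in X n) = P x && (sz x == n)).

Lemma enumerates_filter (T : eqType) (sz : T -> nat) (P Q : pred T) X :
  enumerates sz P X ->
  enumerates sz (predI Q P) (fun n => [seq x <- X n | Q x]).
Proof.
move=> eX n; have [uX mX] := eX n; split=> [|x]; first exact: filter_uniq.
by rewrite mem_filter mX /= andbA.
Qed.

Lemma enumerates_mul (T U : eqType) (sz1 : T -> nat) (sz2 : U -> nat) P1 P2 X Y :
  enumerates sz1 P1 X -> enumerates sz2 P2 Y ->
  enumerates (fun p => sz1 p.1 + sz2 p.2)%N (fun p => P1 p.1 && P2 p.2)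
    (class_mul X Y).
Proof.
move=> eX eY n; split.
  apply: allpairs_uniq_dep => [|k _|]; first exact: iota_uniq.
    by apply: allpairs_uniq => [||[? ?] [? ?] _ _ //];
      [have [] := eX k | have [] := eY (n - k)%N].
  (* The lists for different [k] are disjoint, since [k] is recovered as the size of the first
     component. *)
  have tagE z : z \in [seq @Tagged nat k (fun=> (T * U)%type) p | k <- iota 0 n.+1,
      p <- [seq (x, y) | x <- X k, y <- Y (n - k)%N]] ->
      tag z = sz1 (tagged z).1.
    move=> /flattenP[_ /mapP[k _ ->] /mapP[_ /allpairsP[[x y] [/= xX _ ->]] ->]].
    by move: xX; have [_ ->] := eX k; move=> /andP[_ /eqP <-].
  move=> [k1 p1] [k2 p2] /tagE/= -> /tagE/= -> /= -> //.
move=> [x y] /=; apply/allpairsPdep/idP => [[k [p [kn]]]|].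
  move=> /allpairsP[[x' y'] /= [+ + ->]] [-> ->].
  have [_ ->] := eX k; have [_ ->] := eY (n - k)%N.
  move=> /andP[-> /eqP->] /andP[-> /eqP->] /=.
  by move: kn; rewrite mem_iota => /andP[_ kn]; apply/eqP; lia.
move=> /andP[/andP[Px Py] /eqP szn].
exists (sz1 x), (x, y); split=> //; first by rewrite mem_iota; lia.
apply/allpairsP; exists (x, y) => /=; split=> //.
  by have [_ ->] := eX (sz1 x); rewrite Px eqxx.
by have [_ ->] := eY (n - sz1 x)%N; rewrite Py; apply/eqP; lia.
Qed.

Lemma class_gfM (R : nzRingType) (T U : eqType) (X : nat -> seq T)
    (Y : nat -> seq U) :
  class_gf R (class_mul X Y) = fps_mul (class_gf R X) (class_gf R Y).
Proof.
apply: fps_ext => n /=.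
rewrite /class_mul size_allpairs_dep sumnE big_map -[iota 0 n.+1]/(index_iota 0 n.+1).
rewrite big_mkord natr_sum; apply: eq_bigr => i _.
by rewrite size_allpairs natrM.
Qed.

Lemma coef_fpsD (R : zmodType) (f g : fps R) n :
  (f + g).[# n] = f.[# n] + g.[# n].
Proof. by []. Qed.

Lemma coef_fpsXM (R : comNzRingType) (f : fps R) n :
  (fpsX R * f).[# n] = if n is k.+1 then f.[# k] else 0.
Proof.
case: n => [|n] /=; first by rewrite big_ord1 mul0r.
rewrite big_ord_recl /= mul0r add0r big_ord_recl /= mul1r subn1 /= big1 ?addr0 //.
by move=> i _; rewrite mul0r.
Qed.

(** * King words *)

Definition nonadjacent (a b : nat) : bool := ((a.+1 < b) || (b.+1 < a))%N.

Definition king_word (s : seq nat) : bool :=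
  perm_eq s (iota 0 (size s)) && sorted nonadjacent s.

Definition king_words n : seq (seq nat) :=
  [seq s <- permutations (iota 0 n) | sorted nonadjacent s].

(** In a king word [(size s).-1] is the largest letter. The empty word qualifies, its [ohead] being
    [None], so B(t) has constant term 1. *)
Definition nonmax_head (s : seq nat) : bool := ohead s != Some (size s).-1.

Definition nonmax_king_words n : seq (seq nat) :=
  [seq s <- king_words n | nonmax_head s].

Lemma enumerates_king_words : enumerates size king_word king_words.
Proof.
move=> n; split=> [|s]; first by rewrite filter_uniq ?permutations_uniq.
rewrite mem_filter mem_permutations /king_word andbC -andbA.
have [E | neq] := eqVneq (size s) n; first by rewrite E andbT.
rewrite !andbF; apply/negbTE/negP => /andP[/perm_size]; rewrite size_iota.
by move/eqP: neq.
Qed.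

Lemma enumerates_nonmax :
  enumerates size (predI nonmax_head king_word) nonmax_king_words.
Proof. exact: enumerates_filter enumerates_king_words. Qed.

(** All letters of [s] are below [size s], so the only letter too close to it is the maximum of [s],
    and only the head of [s] is next to it. *)
Lemma path_nonadjacent_size (s : seq nat) : perm_eq s (iota 0 (size s)) ->
  path nonadjacent (size s) s = sorted nonadjacent s && nonmax_head s.
Proof.
case: s => // x s ps; have xs : (x <= size s)%N.
  by have := perm_mem ps x; rewrite mem_head mem_iota => /esym.
rewrite /= andbC /nonmax_head /=; congr (_ && _).
by rewrite /nonadjacent -[Some x == _]/(x == size s); lia.
Qed.

Lemma king_word_cons_size s :
  king_word (size s :: s) = king_word s && nonmax_head s.
Proof.
rewrite /king_word [size (_ :: _)]/= -[in iota 0 _]addn1 iotaD cats1 add0n.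
rewrite perm_sym perm_rcons perm_cons perm_sym -andbA.
exact/andb_id2l/path_nonadjacent_size.
Qed.

(** The coefficient form of A = (1 + t) B: removing the leading maximum [n] is a bijection onto the
    king words of length [n] that do not start with their maximum. *)
Lemma size_king_wordsS n : (size (king_words n.+1) =
  size (nonmax_king_words n.+1) + size (nonmax_king_words n))%N.
Proof.
rewrite -(count_predC nonmax_head (king_words n.+1)) size_filter; congr addn.
have [uK mK] := enumerates_king_words n.+1.
have [uB mB] := enumerates_nonmax n.
rewrite -size_filter -(size_map (cons n) (nonmax_king_words n)).
apply/perm_size/uniq_perm; first exact: filter_uniq.
  by rewrite map_inj_uniq // => ? ? [].
move=> s; rewrite mem_filter mK; apply/idP/mapP => [|[s' + ->]].
  case: s => [|x s]; rewrite /= ?andbF //.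
  rewrite {1}/nonmax_head negbK => /andP[/eqP [->] /andP[]]; rewrite king_word_cons_size.
  move=> /andP[ks hs] /eqP [<-]; exists s => //.
  by rewrite (enumerates_nonmax _).2 /= ks hs eqxx.
rewrite mB => /andP[/andP[hs ks] /eqP <-].
by rewrite king_word_cons_size ks hs /= /nonmax_head /= !eqxx.
Qed.

Lemma king_words_gf (R : comNzRingType) :
  class_gf R king_words = (1 + fpsX R) * class_gf R nonmax_king_words.
Proof.
rewrite mulrDl mul1r; apply: fps_ext => n.
rewrite coef_fpsD coef_fpsXM.
case: n => [|n]; first by rewrite addr0.
by rewrite /= size_king_wordsS natrD.
Qed.

(** * One-line words of permutations *)

Definition word n (s : 'S_n) : seq nat := [seq val (s i) | i <- enum 'I_n].

Lemma size_word n (s : 'S_n) : size (word s) = n.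
Proof. by rewrite size_map size_enum_ord. Qed.

Lemma nth_word n (s : 'S_n) (i : 'I_n) : nth 0%N (word s) i = s i.
Proof. by rewrite (nth_map i) ?size_enum_ord // nth_ord_enum. Qed.

Lemma word_inj n : injective (@word n).
Proof.
move=> s1 s2 E; apply/permP => i; apply: val_inj.
by rewrite /= -!nth_word E.
Qed.

Lemma perm_word n (s : 'S_n) : perm_eq (word s) (iota 0 n).
Proof.
rewrite -val_enum_ord /word map_comp perm_map //.
apply: uniq_perm => [||i]; rewrite ?enum_uniq //.
  by rewrite map_inj_uniq ?enum_uniq //; apply: perm_inj.
rewrite mem_enum; apply/mapP; exists (s^-1%g i).
  by rewrite mem_enum.
by rewrite permKV.
Qed.

Lemma word_surj n (w : seq nat) : perm_eq w (iota 0 n) -> exists s : 'S_n, word s = w.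
Proof.
move=> perm_w; have szw : size w = n by rewrite (perm_size perm_w) size_iota.
have uw : uniq w by rewrite (perm_uniq perm_w) iota_uniq.
have lt_w (i : 'I_n) : (nth 0 w i < n)%N.
  suff : nth 0%N w i \in iota 0 n by rewrite mem_iota.
  by rewrite -(perm_mem perm_w) mem_nth ?szw.
have inj : injective (fun i : 'I_n => Ordinal (lt_w i)).
  move=> i j [] /eqP; rewrite nth_uniq ?szw // => /eqP E; exact: val_inj.
exists (perm inj); apply: (@eq_from_nth _ 0%N); first by rewrite size_word szw.
move=> i; rewrite size_word => lt_in.
by rewrite (nth_word _ (Ordinal lt_in)) permE.
Qed.

Lemma mem_king n (s : 'S_n) : (s \in king n) = king_word (word s).
Proof.
rewrite inE /king_word size_word perm_word /=.
have dist (a b : nat) : (1 < `|b%:Z - a%:Z|) = nonadjacent a b.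
  by rewrite /nonadjacent; lia.
apply/forallP/(sortedP 0%N) => [H i | H i].
  rewrite size_word => lt_i.
  have /forallP/(_ (Ordinal lt_i))/implyP/(_ (eqxx _)) := H (Ordinal (ltnW lt_i)).
  by rewrite dist -!nth_word.
apply/forallP => j; apply/implyP => /eqP E.
by rewrite dist -!nth_word E; apply: H; rewrite size_word -E.
Qed.

Lemma card_words n (S : {set 'S_n}) (X : seq (seq nat)) : uniq X ->
  (forall w, reflect (exists2 s, s \in S & w = word s) (w \in X)) ->
  #|S| = size X.
Proof.
move=> uX memX; rewrite cardE -(size_map (@word n)).
apply/perm_size/uniq_perm => //.
  by rewrite map_inj_uniq ?enum_uniq //; apply: word_inj.
move=> w; apply/mapP/memX => -[s sS ->]; exists s => //.
  by rewrite mem_enum in sS.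
by rewrite mem_enum.
Qed.

Lemma card_king n : #|king n| = size (king_words n).
Proof.
have [uK mK] := enumerates_king_words n.
apply: card_words => // w; rewrite mK.
apply: (iffP andP) => [[kw /eqP szw] | [s + ->]].
  have /andP[+ _] := kw; rewrite szw => /word_surj[s E].
  by exists s; rewrite ?mem_king E.
by rewrite mem_king size_word.
Qed.

Lemma king_gfE (R : nzRingType) : king_gf R = class_gf R king_words.
Proof. by apply: fps_ext => n /=; rewrite card_king. Qed.

(** * Occurrences of the pattern *)

(** Each column of the grid has a single unshaded box: (0,2), (1,0) and (2,1). They confine the
    letters before, between and after the two positions. *)
Lemma occurrenceP n (s : 'S_n) (i j : 'I_n) :
  reflect [/\ (i < j)%N, (s i < s j)%N,
    forall m : 'I_n, (m < i)%N -> (s j < s m)%N,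
    forall m : 'I_n, (i < m < j)%N -> (s m < s i)%N &
    forall m : 'I_n, (j < m)%N -> (s i < s m < s j)%N]
  ((i, j) \in occurrences12 R_boxes s).
Proof.
(* Injectivity keeps the other letters off the grid lines, so a letter outside the shaded boxes of
   its column is in the open one. *)
have neq (a b : 'I_n) : (a < b)%N -> nat_of_ord (s a) <> s b.
  by move=> ab /val_inj/perm_inj E; move: ab; rewrite E ltnn.
rewrite inE /=; apply: (iffP and3P) => [[ij sij /forall_inP box] | [ij sij Hl Hm Hr]].
  have box_empty (a b : nat) (a3 : (a < 3)%N) (b3 : (b < 3)%N) (m : 'I_n) :
      (a, b) \in [:: (0, 0); (0, 1); (1, 1); (1, 2); (2, 0); (2, 2)]%N ->
      ~~ [&& pos_line i j a < m.+1 < pos_line i j a.+1 &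
             val_line s i j b < (s m).+1 < val_line s i j b.+1]%N.
    move=> ab; have := box (Ordinal a3, Ordinal b3); rewrite inE /= ab.
    by move=> /(_ isT)/existsPn/(_ m).
  split=> // m mlt.
  - have := box_empty 0%N 0%N isT isT m isT; have := box_empty 0%N 1%N isT isT m isT.
    by rewrite /pos_line /val_line /=; have := neq m i; have := neq m j; lia.
  - have := box_empty 1%N 1%N isT isT m isT; have := box_empty 1%N 2%N isT isT m isT.
    rewrite /pos_line /val_line /=.
    by have := neq i m; have := neq m j; have := ltn_ord (s m); lia.
  - have := box_empty 2%N 0%N isT isT m isT; have := box_empty 2%N 2%N isT isT m isT.
    rewrite /pos_line /val_line /=.
    have := neq i m; have := neq j m; have := ltn_ord (s m); have := ltn_ord m.
    by lia.
split=> //; apply/forall_inP => -[[a a3] [b b3]]; rewrite inE /= => ab.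
apply/existsPn => m; have {}Hl := Hl m; have {}Hm := Hm m; have {}Hr := Hr m.
by move: ab; rewrite !inE => /or4P[|||/or3P[||]] /eqP [-> ->];
   rewrite /pos_line /val_line /=; lia.
Qed.

(** If [i < i'], then [i] precedes the second occurrence, so [s j' < s i]. From [j] on all letters
    exceed [s i], hence [j' < j]. But then [j] follows [j'], which forces [s j < s j' < s i], a
    contradiction. *)
Lemma occurrence_fst_le n (s : 'S_n) (i j i' j' : 'I_n) :
  (i, j) \in occurrences12 R_boxes s -> (i', j') \in occurrences12 R_boxes s ->
  (i' <= i)%N.
Proof.
move=> /occurrenceP[ij sij Hl Hm Hr] /occurrenceP[ij' sij' Hl' Hm' Hr'].
rewrite leqNgt; apply/negP => lt_ii; have lt_ji := Hl' i lt_ii.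
have [lt | lt | /val_inj E] := ltngtP i' j.
- have [lt' | lt' | /val_inj E] := ltngtP j' j.
  + by have := Hr' j lt'; lia.
  + by have := Hr j' lt'; lia.
  + by move: lt_ji; rewrite E; lia.
- by have := Hr i' lt; lia.
- by move: sij'; rewrite E; lia.
Qed.

(** By symmetry two occurrences share their first position. If the second positions differed, the
    smaller would lie strictly inside the other occurrence, and its letter would be below [s i]
    instead of above it. *)
Lemma nocc12_le1 n (s : 'S_n) : (nocc12 R_boxes s <= 1)%N.
Proof.
apply/card_le1_eqP => -[i j] [i' j'] occ occ'.
have /val_inj E : val i = val i' :> nat.
  by apply/eqP; rewrite eqn_leq !(occurrence_fst_le occ occ', occurrence_fst_le occ' occ).
move: E occ occ' => <- /occurrenceP[ij sij _ Hm _] /occurrenceP[ij' sij' _ Hm' _].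
congr (_, _); apply: val_inj => /=.
have [lt|lt|//] := ltngtP j j'.
  by have := Hm' j; lia.
by have := Hm j'; lia.
Qed.

(** With its converse [split_of_occurrence], this replaces pairs of positions by factorisations of
    the word. *)
Lemma occurrence_of_split n (s : 'S_n) x y H L M (i j : 'I_n) :
  word s = H ++ x :: L ++ y :: M -> (x < y)%N -> all (ltn y) H ->
  all (gtn x) L -> all (fun v => x < v < y)%N M ->
  i = size H :> nat -> j = (size H + size L).+1 :> nat ->
  (i, j) \in occurrences12 R_boxes s.
Proof.
move=> Ew xy /(all_nthP 0%N) Hy /(all_nthP 0%N) Lx /(all_nthP 0%N) Mxy Ei Ej.
have szw : n = (size H + size L + size M).+2.
  by rewrite -[LHS](size_word s) Ew size_cat /= size_cat /=; lia.
have si : s i = x :> nat by rewrite -nth_word Ew Ei nth_cat ltnn subnn.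
have sj : s j = y :> nat.
  by rewrite -nth_word Ew Ej -addnS -nth_drop drop_size_cat //= nth_cat ltnn subnn.
apply/occurrenceP; rewrite si sj; split=> // [|m mi|m /andP[im mj]|m jm].
- by lia.
- by rewrite -nth_word Ew nth_cat -Ei mi; apply: Hy; rewrite -Ei.
- have -> : nat_of_ord (s m) = nth 0%N L (m - i.+1).
    rewrite -nth_word Ew nth_cat ltnNge -Ei (ltnW im) /=.
    by rewrite -[(m - i)%N](subnSK im) /= nth_cat; case: ifP => //; lia.
  by apply: Lx; lia.
have -> : nat_of_ord (s m) = nth 0%N M (m - j.+1).
  rewrite -nth_word Ew -[X in nth _ _ X](subnKC jm) -nth_drop Ej.
  rewrite -addnS -addnS -[(size H + (size L).+2)%N]addnC -drop_drop.
  rewrite drop_size_cat //= -addn1 addnC -drop_drop drop_size_cat //=.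
  by rewrite drop0.
by apply: Mxy; have := ltn_ord m; lia.
Qed.

Lemma split_of_occurrence n (s : 'S_n) (i j : 'I_n) :
  (i, j) \in occurrences12 R_boxes s -> exists x y H L M,
  [/\ word s = H ++ x :: L ++ y :: M, (x < y)%N, all (ltn y) H,
      all (gtn x) L & all (fun v => x < v < y)%N M].
Proof.
move=> /occurrenceP[ij sij Hl Hm Hr]; set w := word s.
have szw : size w = n := size_word s.
have nthw k (lt_kn : (k < n)%N) : nth 0%N w k = s (Ordinal lt_kn).
  exact: (nth_word s (Ordinal lt_kn)).
exists (s i), (s j), (take i w), (take (j - i.+1) (drop i.+1 w)), (drop j.+1 w).
split=> //.
- rewrite -[LHS](cat_take_drop i) (drop_nth 0%N) ?szw // nth_word.
  congr (_ ++ _ :: _); rewrite -[LHS](cat_take_drop (j - i.+1)); congr (_ ++ _).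
  by rewrite drop_drop subnK // (drop_nth 0%N) ?szw // nth_word.
- apply/(all_nthP 0%N) => k; rewrite size_takel ?szw; last exact: ltnW.
  move=> ki; have kn := ltn_trans ki (ltn_ord i).
  by rewrite nth_take // (nthw k kn); apply: Hl.
- apply/(all_nthP 0%N) => k; rewrite size_takel ?size_drop ?szw; last first.
    by have := ltn_ord j; lia.
  move=> kij; have kn : (i.+1 + k < n)%N by have := ltn_ord j; lia.
  by rewrite nth_take // nth_drop (nthw _ kn); apply: Hm => /=; lia.
apply/(all_nthP 0%N) => k; rewrite size_drop szw => kj.
have kn : (j.+1 + k < n)%N by lia.
by rewrite nth_drop (nthw _ kn); apply: Hr => /=; lia.
Qed.

(** * Assembling a word with an occurrence from three standardised blocks *)

(** Values increase in the order L, x, M, y, H, so x is [size L] and y is [(size L + size M).+1].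
    The shifts undo the standardisation of M and H; L needs none. *)
Definition assemble (p : seq nat * (seq nat * seq nat)) : seq nat :=
  let: (H, (L, M)) := p in
  [seq size L + size M + 2 + v | v <- H]%N ++
  size L :: L ++ (size L + size M).+1 :: [seq (size L).+1 + v | v <- M]%N.

Lemma size_assemble H L M :
  size (assemble (H, (L, M))) = (size H + (size L + size M)).+2.
Proof. by rewrite /assemble size_cat /= size_cat /= !size_map; lia. Qed.

Lemma perm_assemble (H L M : seq nat) :
  perm_eq H (iota 0 (size H)) -> perm_eq L (iota 0 (size L)) ->
  perm_eq M (iota 0 (size M)) ->
  perm_eq (assemble (H, (L, M))) (iota 0 (size (assemble (H, (L, M))))).
Proof.
move=> pH pL pM; rewrite size_assemble.
(* The length is regrouped in the order of values, so that [iotaD] cuts the interval at the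
   blocks. *)
have -> : (size H + (size L + size M)).+2
    = (size L + (1 + (size M + (1 + size H))))%N by lia.
rewrite !iotaD !add0n; apply/seq.permP => P.
have shift a s : perm_eq s (iota 0 (size s)) ->
    count P [seq a + v | v <- s]%N = count P (iota a (size s)).
  by move=> ps; rewrite -[in RHS](addn0 a) iotaDl; apply/seq.permP/perm_map.
rewrite !count_cat /= !count_cat /= !shift // (seq.permP pL) !addn1 addn2 addn0 !addSn.
by move: (count P _) (count P _) (count P _) (nat_of_bool _) (nat_of_bool _); lia.
Qed.

Lemma nonadjacentD a : {mono addn a : b c / nonadjacent b c}.
Proof. by move=> b c; rewrite /nonadjacent; lia. Qed.

(** Meant for H followed by x: every letter of H exceeds x by at least two, so this junction adds no
    condition. *)
Lemma sorted_cat_cons (T : eqType) (r : rel T) s1 x s2 : all (r^~ x) s1 ->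
  sorted r (s1 ++ x :: s2) = sorted r s1 && path r x s2.
Proof.
by case: s1 => // a s1 /allP rx; rewrite /= cat_path /= rx // mem_last.
Qed.

(* The only adjacencies that assembling can create are those of the two
   inserted letters with the head of the block following them, or with each
   other when both low and middle blocks are empty. *)
Lemma sorted_assemble (H L M : seq nat) :
  perm_eq L (iota 0 (size L)) -> perm_eq M (iota 0 (size M)) ->
  sorted nonadjacent (assemble (H, (L, M))) =
  [&& sorted nonadjacent H, sorted nonadjacent L && nonmax_head L,
      sorted nonadjacent M && nonmax_head M & (L, M) != ([::], [::])].
Proof.
move=> pL pM; rewrite /assemble sorted_cat_cons; last first.
  by rewrite all_map; apply/allP => v _; rewrite /= /nonadjacent; lia.
rewrite sorted_map (eq_sorted (nonadjacentD _)); congr (_ && _).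
(* Relative to the shift [(size L).+1] of M, the letter y is [size M], and [path_nonadjacent_size]
   applies. *)
have pathM : path nonadjacent (size L + size M).+1 [seq (size L).+1 + v | v <- M]%N
    = sorted nonadjacent M && nonmax_head M.
  by rewrite -path_nonadjacent_size // -addSn path_map (eq_path (nonadjacentD _)).
rewrite cat_path /= pathM -(path_nonadjacent_size pL).
case: L pL {pathM} => [|a L] pL /=.
  rewrite andbC; congr (_ && _); rewrite /nonadjacent.
  by case: M {pM}.
rewrite andbT; congr (_ && _).
(* The last letter of the low block is below x, hence at least two below y. *)
have : last a L \in iota 0 (size L).+1 by rewrite -(perm_mem pL) mem_last.
by rewrite mem_iota /nonadjacent => ?; case: (sorted _ M && _); lia.
Qed.

Lemma filter_itv_iota n a b : (b <= n)%N ->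
  [seq v <- iota 0 n | a <= v < b]%N = iota a (b - a).
Proof.
move=> bn; apply: (irr_sorted_eq ltn_trans ltnn).
- exact: sorted_filter ltn_trans _ _ (iota_ltn_sorted _ _).
- exact: iota_ltn_sorted.
by move=> v; rewrite mem_filter !mem_iota; lia.
Qed.

Lemma perm_iota_shift a k (s : seq nat) : perm_eq s (iota a k) ->
  exists2 s', s = [seq a + v | v <- s']%N & perm_eq s' (iota 0 (size s')).
Proof.
move=> ps; exists [seq v - a | v <- s]%N.
  rewrite -map_comp -[LHS]map_id; apply/eq_in_map => v.
  by rewrite (perm_mem ps) mem_iota /=; lia.
rewrite size_map (perm_size ps) size_iota.
have -> : iota 0 k = [seq v - a | v <- iota a k]%N.
  rewrite -[in RHS](addn0 a) iotaDl -map_comp -[LHS]map_id; apply/eq_map => v.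
  by rewrite /=; lia.
exact: perm_map.
Qed.

Lemma filter_nil (T : Type) (P : pred T) s : all (predC P) s -> filter P s = [::].
Proof. by elim: s => //= x s IHs /andP[/negbTE -> /IHs]. Qed.

(** The bounds separate H, L and M by value, so filtering [w] by a suitable interval of values
    returns exactly one block. As [w] is a permutation, that block is a permutation of the interval;
    shifting it down to 0 standardises it. *)
Lemma split_perm_assemble (w : seq nat) x y H L M :
  w = H ++ x :: L ++ y :: M -> (x < y)%N -> all (ltn y) H ->
  all (gtn x) L -> all (fun v => x < v < y)%N M -> perm_eq w (iota 0 (size w)) ->
  exists H' M', [/\ w = assemble (H', (L, M')), perm_eq H' (iota 0 (size H')),
    perm_eq L (iota 0 (size L)) & perm_eq M' (iota 0 (size M'))].
Proof.
move=> Ew xy Hy Lx Mxy pw; set n := size w in pw.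
have lt_n v : v \in w -> (v < n)%N by rewrite (perm_mem pw) mem_iota.
have yn : (y < n)%N.
  by apply: lt_n; rewrite Ew !(mem_cat, inE) eqxx !orbT.
have block a b : (b <= n)%N ->
    perm_eq [seq v <- w | a <= v < b]%N (iota a (b - a)).
  by move=> bn; rewrite -(filter_itv_iota _ bn) perm_filter.
have inside (P Q : pred nat) s : all Q s -> {subset Q <= P} -> filter P s = s.
  by move=> aQ QP; apply/all_filterP; apply: sub_all aQ => v /QP.
have outside (P Q : pred nat) s :
    all Q s -> {subset Q <= predC P} -> filter P s = [::].
  by move=> aQ QP; apply: filter_nil; apply: sub_all aQ => v /QP.
have pL : perm_eq L (iota 0 x).
  have := block 0%N x (ltnW (ltn_trans xy yn)).
  rewrite subn0 Ew filter_cat /= ltnn filter_cat /= [(y < x)%N]ltnNge (ltnW xy).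
  rewrite (outside _ _ _ Hy) ?(inside _ _ _ Lx) ?(outside _ _ _ Mxy) /= ?cats0 //;
    by move=> v; rewrite !unfold_in /=; lia.
have pM : perm_eq M (iota x.+1 (y - x.+1)).
  have := block x.+1 y (ltnW yn).
  rewrite Ew filter_cat /= ltnn filter_cat /= ltnn andbF.
  rewrite (outside _ _ _ Hy) ?(outside _ _ _ Lx) ?(inside _ _ _ Mxy) //;
    by move=> v; rewrite !unfold_in /=; lia.
(* The block H is bounded above only by the length of the permutation. *)
have Hyn : all (fun v => y < v < n)%N H.
  apply/allP => v vH; have := allP Hy v vH; have := lt_n v.
  by rewrite Ew mem_cat vH => /(_ isT) /=; lia.
have pH : perm_eq H (iota y.+1 (n - y.+1)).
  have := block y.+1 n (leqnn n).
  rewrite Ew filter_cat /= filter_cat /= ltnn [(y < x)%N]ltnNge (ltnW xy) /=.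
  rewrite (inside _ _ _ Hyn) ?(outside _ _ _ Lx) ?(outside _ _ _ Mxy) ?cats0 //;
    by move=> v; rewrite !unfold_in /=; lia.
have szL : size L = x by rewrite (perm_size pL) size_iota.
have szM : size M = (y - x.+1)%N by rewrite (perm_size pM) size_iota.
have [H' EH pH'] := perm_iota_shift pH; have [M' EM pM'] := perm_iota_shift pM.
exists H', M'; split=> //; last by rewrite szL.
have szM' : size M' = (y - x.+1)%N by rewrite -szM EM size_map.
rewrite Ew EH EM /assemble szL szM'.
have -> : (x + (y - x.+1) + 2)%N = y.+1 by lia.
by have -> : (x + (y - x.+1)).+1 = y by lia.
Qed.

Lemma occurrence_assemble n (s : 'S_n) (H L M : seq nat) (i j : 'I_n) :
  perm_eq L (iota 0 (size L)) -> perm_eq M (iota 0 (size M)) ->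
  word s = assemble (H, (L, M)) ->
  i = size H :> nat -> j = (size H + size L).+1 :> nat ->
  (i, j) \in occurrences12 R_boxes s.
Proof.
move=> pL pM Ew Ei Ej; apply: (occurrence_of_split Ew); rewrite ?size_map //.
- by lia.
- by rewrite all_map; apply/allP => v _ /=; lia.
- by apply/allP => v; rewrite (perm_mem pL) mem_iota.
by rewrite all_map; apply/allP => v; rewrite (perm_mem pM) mem_iota /=; lia.
Qed.

(** The block sizes are read off the positions of the occurrence, which is unique by [nocc12_le1].
    With equal sizes the two words are compared block by block. *)
Lemma assemble_inj (H L M H' L' M' : seq nat) :
  perm_eq H (iota 0 (size H)) -> perm_eq L (iota 0 (size L)) ->
  perm_eq M (iota 0 (size M)) -> perm_eq L' (iota 0 (size L')) ->
  perm_eq M' (iota 0 (size M')) ->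
  assemble (H, (L, M)) = assemble (H', (L', M')) ->
  (H, (L, M)) = (H', (L', M')).
Proof.
move=> pH pL pM pL' pM' E.
have [s Ew] := word_surj (perm_assemble pH pL pM).
have Ew' := etrans Ew E.
have sz := size_assemble H L M; have sz' := size_assemble H' L' M'.
rewrite -E sz in sz'.
have i_n : (size H < size (assemble (H, (L, M))))%N by lia.
have j_n : ((size H + size L).+1 < size (assemble (H, (L, M))))%N by lia.
have i'_n : (size H' < size (assemble (H, (L, M))))%N by lia.
have j'_n : ((size H' + size L').+1 < size (assemble (H, (L, M))))%N by lia.
have occ : (Ordinal i_n, Ordinal j_n) \in occurrences12 R_boxes s.
  exact: occurrence_assemble Ew _ _.
have occ' : (Ordinal i'_n, Ordinal j'_n) \in occurrences12 R_boxes s.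
  exact: occurrence_assemble Ew' _ _.
have /card_le1_eqP /(_ _ _ occ occ') [szH szHL] := nocc12_le1 s.
have szL : size L = size L' by lia.
have szM : size M = size M' by lia.
move/eqP: E; rewrite /assemble szL szM eqseq_cat ?size_map //.
move=> /andP[/eqP /(inj_map (@addnI _)) ->] /eqP [/eqP].
rewrite eqseq_cat // => /andP[/eqP -> /eqP []].
by move=> /(inj_map (@addnI _)) ->.
Qed.

(** * Counting the king permutations with an occurrence *)

(** With both blocks empty, x and y would be neighbours with consecutive values. *)
Definition nonmax_pairs n : seq (seq nat * seq nat) :=
  [seq p <- class_mul nonmax_king_words nonmax_king_words n
     | p != ([::], [::])].

Definition occ_triples : nat -> seq (seq nat * (seq nat * seq nat)) :=
  class_mul king_words nonmax_pairs.

Definition occ_words n : seq (seq nat) :=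
  if n is k.+2 then [seq assemble p | p <- occ_triples k] else [::].

Lemma enumerates_nonmax_pairs :
  enumerates (fun p => size p.1 + size p.2)%N
    (predI [pred p | p != ([::], [::])]
       (fun p => predI nonmax_head king_word p.1 && predI nonmax_head king_word p.2))
    nonmax_pairs.
Proof.
exact: enumerates_filter (enumerates_mul enumerates_nonmax enumerates_nonmax).
Qed.

(** By [sorted_assemble], the conditions on the three blocks amount to the king condition on the
    assembled word. *)
Lemma mem_occ_triples n H L M :
  ((H, (L, M)) \in occ_triples n) =
  [&& perm_eq H (iota 0 (size H)), perm_eq L (iota 0 (size L)),
      perm_eq M (iota 0 (size M)), sorted nonadjacent (assemble (H, (L, M)))
    & (size H + (size L + size M))%N == n].
Proof.
have [_ ->] := enumerates_mul enumerates_king_words enumerates_nonmax_pairs n.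
rewrite /= /king_word.
case pH: (perm_eq H _); rewrite ?andbF //.
case pL: (perm_eq L _); rewrite ?andbF //.
case pM: (perm_eq M _); rewrite ?andbF //.
rewrite (sorted_assemble _ pL pM) /=; congr (_ && _).
by rewrite -!andbA; do !bool_congr.
Qed.

Lemma occ_triples_uniq n : uniq (occ_triples n).
Proof.
by have [] := enumerates_mul enumerates_king_words enumerates_nonmax_pairs n.
Qed.

(** From length two on, [assemble] is a bijection: [assemble_inj] gives injectivity, and cutting at
    an occurrence gives surjectivity. *)
Lemma card_king_occ n :
  #|[set s in king n | nocc12 R_boxes s != 0%N]| = size (occ_words n).
Proof.
(* With fewer than two letters there is no occurrence, and the list is empty. *)
case: n => [|[|n]].
- apply/eqP; rewrite cards_eq0; apply/eqP/setP => s; rewrite !inE.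
  by apply/negbTE; rewrite negb_and negbK cards_eq0 orbC; apply/orP; left;
     apply/eqP/setP => -[[]].
- apply/eqP; rewrite cards_eq0; apply/eqP/setP => s; rewrite !inE.
  apply/negbTE; rewrite negb_and negbK cards_eq0 orbC; apply/orP; left.
  by apply/eqP/setP => -[i j]; rewrite !inE !ord1.
apply: card_words.
  rewrite map_inj_in_uniq ?occ_triples_uniq // => -[H [L M]] [H' [L' M']].
  rewrite !mem_occ_triples => /and5P[pH pL pM _ _] /and5P[_ pL' pM' _ _].
  exact: assemble_inj.
move=> w; apply: (iffP mapP) => [[[H [L M]]] | [s]].
  rewrite mem_occ_triples => /and5P[pH pL pM so /eqP szn] Ew.
  have szw : size w = n.+2 by rewrite Ew size_assemble szn.
  have pw : perm_eq w (iota 0 (size w)) by rewrite Ew perm_assemble.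
  have [s Es] : exists s : 'S_n.+2, word s = w by apply: word_surj; rewrite -szw.
  exists s => //; rewrite inE mem_king Es /king_word pw Ew so /=.
  have i_n : (size H < n.+2)%N by lia.
  have j_n : ((size H + size L).+1 < n.+2)%N by lia.
  rewrite -lt0n; apply/card_gt0P; exists (Ordinal i_n, Ordinal j_n).
  exact: occurrence_assemble (etrans Es Ew) _ _.
rewrite inE mem_king -lt0n => /andP[/andP[pw so] /card_gt0P[[i j]]].
move=> /split_of_occurrence[x [y [H [L [M [Ew xy Hy Lx Mxy]]]]]] ->.
have [H' [M' [Ea pH pL pM]]] := split_perm_assemble Ew xy Hy Lx Mxy pw.
exists (H', (L, M')) => //; rewrite mem_occ_triples pH pL pM -Ea so /=.
by have := size_assemble H' L M'; rewrite -Ea size_word => -[->].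
Qed.

(** * Generating functions *)

(** The excluded pair of empty words has total size 0, which accounts for the constant 1. *)
Lemma nonmax_pairs_gf (R : comNzRingType) :
  class_gf R nonmax_pairs = class_gf R nonmax_king_words ^+ 2 - 1.
Proof.
apply/eqP; rewrite eq_sym subr_eq eq_sym; apply/eqP.
rewrite expr2 -[_ * _]class_gfM; apply: fps_ext => n.
rewrite coef_fpsD /= -(count_predC (pred1 ([::], [::])) (class_mul _ _ n)) natrD.
rewrite addrC size_filter; congr (_ + _).
have [u m] := enumerates_mul enumerates_nonmax enumerates_nonmax n.
by rewrite count_uniq_mem // m /=; case: n {u m}.
Qed.

Lemma occ_words_gf (R : comUnitRingType) : class_gf R occ_words =
  fpsX R ^+ 2 * (king_gf R * (king_gf R ^+ 2 / (1 + fpsX R) ^+ 2 - 1)).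
Proof.
have /andP[U _] := fps_unit_1X R.
(* This is B = A / (1 + t), squared. *)
have -> : king_gf R ^+ 2 / (1 + fpsX R) ^+ 2 = class_gf R nonmax_king_words ^+ 2.
  by rewrite king_gfE king_words_gf exprMn mulrC mulKr // unitrX.
rewrite -nonmax_pairs_gf king_gfE -[_ * class_gf _ _]class_gfM.
rewrite expr2 -mulrA; apply: fps_ext => n.
rewrite coef_fpsXM; case: n => [|n] //; rewrite coef_fpsXM.
by case: n => [|n] //=; rewrite size_map.
Qed.

Lemma king_avoid12_gfE :
  king_avoid12_gf R_boxes = king_gf int - class_gf int occ_words.
Proof.
apply/eqP; rewrite eq_sym subr_eq eq_sym; apply/eqP; apply: fps_ext => n.
rewrite coef_fpsD /= -card_king_occ -natrD; congr (_%:R).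
rewrite -(cardsID [set s | nocc12 R_boxes s == 0%N] (king n)).
by congr (_ + _)%N; apply: eq_card => s; rewrite !inE // andbC.
Qed.

(** Since the number p of occurrences is 0 or 1, the weight u^p is 1, plus u - 1 when there is an
    occurrence. *)
Lemma coef_king_dist12_gf n : (king_dist12_gf R_boxes).[# n] =
  (size (king_words n))%:R + ('X - 1) * (size (occ_words n))%:R.
Proof.
rewrite /= -card_king -card_king_occ -!sum1_card !natr_sum mulr_sumr.
rewrite [X in _ + X](eq_bigl (fun s => (s \in king n) && (nocc12 R_boxes s != 0%N)));
  last by move=> s; rewrite inE.
rewrite big_mkcondr -big_split /=; apply: eq_bigr => s _.
have := nocc12_le1 s; case: (nocc12 _ _) => [|[|//]] _ /=.
  by rewrite expr0 addr0.
by rewrite expr1 mulr1 addrC subrK.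
Qed.

Lemma king_dist12_gfE : king_dist12_gf R_boxes =
  king_gf {poly int} + fps_const ('X - 1) * class_gf {poly int} occ_words.
Proof.
apply: fps_ext => n; rewrite coef_king_dist12_gf coef_fpsD /= card_king.
by congr (_ + _); rewrite big_ord_recl subn0 /= big1 ?addr0 // => i _; rewrite mul0r.
Qed.

(** * Initial terms and the final formulas *)

Lemma size_king_words_le8 :
  [seq size (king_words n) | n <- iota 0 9] = [:: 1; 1; 0; 0; 2; 14; 90; 646; 5242]%N.
Proof. by vm_compute. Qed.

Lemma size_occ_words_le8 :
  [seq size (occ_words n) | n <- iota 0 9] = [:: 0; 0; 0; 0; 0; 0; 4; 28; 180]%N.
Proof. by vm_compute. Qed.

Theorem theorem3p7 :
  [/\ let t := fpsX int in
      let A := king_gf int in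
      king_avoid12_gf R_boxes = (1 + t ^+ 2 - t ^+ 2 * A ^+ 2 / (1 + t) ^+ 2) * A,
      let t := fpsX {poly int} in
      let u := fps_const ('X : {poly int}) in
      let A := king_gf {poly int} in
      king_dist12_gf R_boxes =
        (1 + t ^+ 2 * (1 - u) * (1 - A ^+ 2 / (1 + t) ^+ 2)) * A
    & let u : {poly int} := 'X in
      [seq (king_dist12_gf R_boxes).[# n] | n <- iota 0 9] =
        [:: 1; 1; 0; 0; 2; 14; 86 + 4 * u; 618 + 28 * u; 5062 + 180 * u]].
Proof.
split=> [t A | t u A | u].
- rewrite king_avoid12_gfE occ_words_gf -/t -/A -[t ^+ 2 * A ^+ 2 / _]mulrA.
  (* With the quotient generalised to a variable, the identity is polynomial. *)
  by move: (A ^+ 2 / _) => B; ring.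
- rewrite king_dist12_gfE occ_words_gf -/t -/A.
  have -> : fps_const ('X - 1) = u - 1 :> fps {poly int}.
    by apply: fps_ext => -[|n] //=; rewrite subr0.
  by move: (A ^+ 2 / _) => B; ring.
(* Each coefficient is determined by the two computed counts. *)
transitivity [seq p.1%:R + ('X - 1) * p.2%:R : {poly int} | p <- zip
    [seq size (king_words n) | n <- iota 0 9] [seq size (occ_words n) | n <- iota 0 9]].
  by rewrite zip_map -map_comp; apply: eq_map => n; rewrite coef_king_dist12_gf.
rewrite size_king_words_le8 size_occ_words_le8.
(* The last identity holds with any number in place of 5062; generalising it spares [ring] a numeral
   of that size. *)
have -> : 5242%N = (5062 + 180)%N by vm_compute.
move: 5062%N (erefl : 5062%:R = 5062 :> {poly int}) => N EN /=.
by rewrite natrD EN /u; move: 'X 5062 => X N';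
   congr [:: _; _; _; _; _; _; _; _; _]; ring.
Qed.
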